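(* Let $\mathrm{STSP}_n\subseteq\{0,1\}^{E_n}$ be the set of characteristic vectors of (undirected) hamiltonian cycles in the complete undirected graph $K_n=(V_n,E_n)$ on $n$ nodes, and let $\mathrm{ATSP}_n\subseteq\{0,1\}^{A_n}$ be the set of characteristic vectors of directed hamiltonian cycles in the complete directed graph on $n$ nodes with arc set $A_n$. Then $\mathrm{rc}(\mathrm{ATSP}_n)=2^{\Theta(n)}$ and $\mathrm{rc}(\mathrm{STSP}_n)=2^{\Theta(n)}$, i.e., there are constants $c_1,c_2>0$ such that $2^{c_1 n}\le \mathrm{rc}(\mathrm{ATSP}_n)\le 2^{c_2 n}$ and $2^{c_1 n}\le \mathrm{rc}(\mathrm{STSP}_n)\le 2^{c_2 n}$ for all sufficiently large $n$.
   Context: For $X\subseteq\mathbb{Z}^d$, a polyhedron $R\subseteq\mathbb{R}^d$ is called a relaxation for $X$ if $R\cap\mathbb{Z}^d=\mathrm{conv}(X)\cap\mathbb{Z}^d$. The relaxation complexity $\mathrm{rc}(X)$ is the smallest number of facets of any relaxation for $X$. For an edge/arc set $F$ of a ground set $E$, its characteristic vector $\chi(F)\in\{0,1\}^E$ has $\chi(F)_e=1$ iff $e\in F$. *)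

(* Defs.v *)
From HB Require Import structures.
From mathcomp Require Import all_boot all_order all_algebra.
From mathcomp Require Import all_classical all_reals.
From mathcomp Require Import ereal exp convex.

Set Implicit Arguments.
Unset Strict Implicit.
Unset Printing Implicit Defensive.

Import Order.TTheory GRing.Theory Num.Theory.
Local Open Scope classical_set_scope.
Local Open Scope ring_scope.

Section RelaxationComplexity.
Variables (R : realType) (E : finType).

(* The space R^E, with coordinates indexed by a finite ground set E; R^o makes
   it a vector space over R. *)
Local Notation V := {ffun E -> R^o}.
Implicit Types (P F S X : set V) (x y a : V).

Definition dot a x : R := \sum_(e : E) a e * x e.

Definition integer_points : set V :=
  [set x | forall e, x e \is a Num.int].

Definition conv_hull X : set V :=
  smallest (fun A : set V => convex_set (A : set (convex_lmodType V))) X.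

Definition polyhedron P : Prop :=
  exists (m : nat) (a : 'I_m -> V) (b : 'I_m -> R),
    P = [set x | forall i, dot (a i) x <= b i].

Definition face P F : Prop :=
  exists (c : V) (delta : R),
    (forall x, P x -> dot c x <= delta) /\
    F = P `&` [set x | dot c x = delta].

(* U is the linear span of the differences of points of S, that is, the
   direction of the affine hull of S. *)
Definition direction S (U : {vspace V}) : Prop :=
  (forall x y, S x -> S y -> x - y \in U) /\
  (forall W : {vspace V},
     (forall x y, S x -> S y -> x - y \in W) -> (U <= W)%VS).

(* The empty set has no dimension here, so facets are nonempty and a
   single point has no facet. *)
Definition has_dim S (k : nat) : Prop :=
  S !=set0 /\ exists2 U, direction S U & \dim U = k.

(* Dimensions are relative to P, which need not be full-dimensional. *)
Definition facet P F : Prop :=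
  face P F /\ exists2 k, has_dim F k & has_dim P k.+1.

Definition relaxation X P : Prop :=
  polyhedron P /\ P `&` integer_points = conv_hull X `&` integer_points.

(* An infimum of natural numbers: the minimum if there is a relaxation
   for X, and +oo otherwise. *)
Definition rc X : \bar R :=
  ereal_inf [set k%:R%:E | k in
    [set k : nat | exists2 P, relaxation X P & (facet P #= `I_k)%card]].

Definition char_vec (F : {set E}) : V := [ffun e => (e \in F)%:R].

End RelaxationComplexity.

Definition edge (n : nat) := {e : {set 'I_n} | #|e| == 2%N}.
Definition darc (n : nat) := {a : 'I_n * 'I_n | a.1 != a.2}.

(* The tuple c lists all n nodes in their cyclic order along the cycle; next c v
   is the node following v. *)
Definition hamiltonian_cycle (n : nat) (F : {set edge n}) : Prop :=
  (2 < n)%N /\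
  exists2 c : n.-tuple 'I_n, uniq c &
    F = [set e : edge n | [exists v, val e == [set v; next c v]%SET]]%SET.

Definition directed_hamiltonian_cycle (n : nat) (F : {set darc n}) : Prop :=
  (1 < n)%N /\
  exists2 c : n.-tuple 'I_n, uniq c &
    F = [set a : darc n | (val a).2 == next c (val a).1]%SET.

Definition STSP (R : realType) (n : nat) : set {ffun edge n -> R^o} :=
  [set char_vec R F | F in [set F | hamiltonian_cycle F]].

Definition ATSP (R : realType) (n : nat) : set {ffun darc n -> R^o} :=
  [set char_vec R F | F in [set F | directed_hamiltonian_cycle F]].

Arguments STSP : clear implicits.
Arguments ATSP : clear implicits.

(* Main.v *)
(* Lower bound: in an irredundant description of a polyhedron, relative to its
   affine hull, every inequality defines a facet, and no two define the same one.
   Hence a set of integer points outside conv(X) but in its affine hull, such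
   that the midpoint of any two of them lies in conv(X), has at most rc(X)
   elements. For n nodes on a circle and l = n / 2, switch the successors of the
   nodes i and l + i for every i in a set B of positions below l. Each switch
   composes the successor permutation with a transposition, so the parity of the
   number of its cycles alternates with each switch; this number is at most 2,
   as every cycle meets {0, l}. The B with an even number of
   cycles, about half of all B, give the hiding set: toggling one position where
   B and B' differ turns both of them into hamiltonian cycles without changing
   the sum of their characteristic vectors.
   Upper bound: box, degree and cut constraints form a relaxation with O(4^n)
   inequalities, and facets of a polyhedron inject into its inequalities. *)
Require Import Defs.
From mathcomp Require Import all_boot all_order all_algebra.
From mathcomp Require Import all_classical all_reals.
From mathcomp Require Import ereal exp.
From HB Require Import structures.
From mathcomp Require Import convex perm zify ring lra.

Set Implicit Arguments.
Unset Strict Implicit.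
Unset Printing Implicit Defensive.

Import Order.TTheory GRing.Theory Num.Theory.
Local Open Scope ring_scope.

(** * Directions, dimensions and facets of finite systems of inequalities *)

Section Polyhedra.
Local Open Scope classical_set_scope.
Variables (R : realType) (E : finType).
Local Notation V := {ffun E -> R^o}.
Implicit Types (P F S : set V) (x y v w : V) (U W : {vspace V}).

Lemma dot_is_linear (a : V) : linear (dot a : V -> R^o).
Proof.
move=> k x y; rewrite /dot scaler_sumr -big_split/=.
by apply: eq_bigr => e _; rewrite !ffunE mulrDr mulrCA.
Qed.

HB.instance Definition _ (a : V) :=
  GRing.isLinear.Build R V R^o *:%R (dot a : V -> R^o) (dot_is_linear a).

Lemma dotD (a x y : V) : dot a (x + y) = dot a x + dot a y.
Proof. exact: (linearD (dot a : V -> R^o)). Qed.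

Lemma dotB (a x y : V) : dot a (x - y) = dot a x - dot a y.
Proof. exact: (linearB (dot a : V -> R^o)). Qed.

Lemma dotZ (a : V) (k : R) x : dot a (k *: x) = k * dot a x.
Proof. exact: (linearZ_LR (dot a : V -> R^o)). Qed.

Definition dotlin (a : V) : 'Hom(V, R^o) := linfun (dot a : V -> R^o).

Lemma mem_lker_dot (a v : V) : (v \in lker (dotlin a)) = (dot a v == 0).
Proof. by rewrite memv_ker lfunE. Qed.

(** Rank-nullity: the image of [U] is nonzero and lies in the one-dimensional space of scalars, so
    its dimension is exactly 1. *)
Lemma dim_cap_lker_dot U (a v : V) : v \in U -> dot a v != 0 ->
  \dim U = (\dim (U :&: lker (dotlin a))).+1.
Proof.
move=> vU av0; rewrite -(limg_ker_dim (dotlin a) U) -addn1; congr addn.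
apply/eqP; rewrite eqn_leq; apply/andP; split.
  by rewrite (leq_trans (dimvS (subvf _)))// dimvf /dim/=.
rewrite lt0n dimv_eq0; apply: contra av0 => /eqP im0.
have := memv_img (dotlin a) vU; rewrite im0 memv0 lfunE/=.
exact.
Qed.

(** By a step from [p], every vector of [U] is a multiple of a difference of two points of [S], so
    no smaller space contains all differences. *)
Lemma directionP S (p : V) U :
  S p -> (forall x y, S x -> S y -> x - y \in U) ->
  (forall v, v \in U -> exists2 e : R, 0 < e & S (p + e *: v)) ->
  direction S U.
Proof.
move=> Sp SU open; split=> // W SW; apply/subvP => v /open[e e0 Sv].
have := SW _ _ Sv Sp; rewrite addrAC subrr add0r => /(memvZ e^-1).
by rewrite scalerA mulVf ?scale1r// gt_eqF.
Qed.

Lemma direction_uniq S U W : direction S U -> direction S W -> U = W.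
Proof.
move=> [SU minU] [SW minW].
by apply/eqP; rewrite eqEsubv (minU _ SW) (minW _ SU).
Qed.

Variables (I : finType) (a : I -> V) (b : I -> R).

Definition halfspaces : set V := [set x | forall i, dot (a i) x <= b i].

Lemma polyhedron_halfspaces : polyhedron halfspaces.
Proof.
exists #|I|, (a \o enum_val), (b \o enum_val); apply/seteqP; split=> x /= Hx i//.
by rewrite -[i]enum_rankK; apply: Hx.
Qed.

Definition tight S (i : I) := `[< forall x, S x -> dot (a i) x = b i >].

Lemma tightP S i : reflect (forall x, S x -> dot (a i) x = b i) (tight S i).
Proof. exact: asboolP. Qed.

(** Plays the role of a relative interior point: a midpoint is strict wherever one of its endpoints
    is, so averaging in one strict point per non-tight inequality suffices. *)
Lemma exists_slack_point S :
  S `<=` halfspaces -> S !=set0 ->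
  (forall x y, S x -> S y -> S (2^-1 *: (x + y))) ->
  exists2 z, S z & forall i, ~~ tight S i -> dot (a i) z < b i.
Proof.
move=> SP [x0 Sx0] Smid.
suff [z Sz zP] : exists2 z, S z &
    forall i, i \in enum I -> ~~ tight S i -> dot (a i) z < b i.
  by exists z => // i; apply: zP; rewrite mem_enum.
elim: (enum I) => [|i s [z Sz zP]]; first by exists x0.
have [/tightP ti|/tightP nti] := boolP (tight S i).
  exists z => // j; rewrite inE => /predU1P[->|js]; last exact: zP.
  by move/negP; case; apply/tightP.
have [x Sx xi] : exists2 x, S x & dot (a i) x < b i.
  apply: contrapT => nex; apply: nti => x Sx; apply/eqP.
  rewrite eq_le (SP _ Sx i) leNgt; apply/negP => xi.
  by apply: nex; exists x.
exists (2^-1 *: (z + x)); first exact: Smid.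
move=> j; rewrite inE dotZ dotD => /predU1P[->|js ntj].
  have := SP _ Sz i; lra.
have := zP j js ntj; have := SP _ Sx j; lra.
Qed.

Lemma exists_slack_step (g h : I -> R) : exists2 e : R, 0 < e &
  forall i, g i < b i -> g i + e * h i <= b i.
Proof.
(* [t] exceeds every ratio [|h i / (b i - g i)|]; the summand 1 keeps it positive, and indices
   without slack only add nonnegative terms. *)
pose t := 1 + \sum_i `|h i / (b i - g i)|.
have s0 (A : pred I) : 0 <= \sum_(i | A i) `|h i / (b i - g i)|.
  exact: sumr_ge0.
have t0 : 0 < t by rewrite ltr_pwDl// s0.
exists t^-1; first by rewrite invr_gt0.
move=> i gb; have d0 : 0 < b i - g i by rewrite subr_gt0.
suff : h i <= t * (b i - g i).
  by rewrite -ler_pdivrMl//; lra.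
rewrite -ler_pdivrMr// (le_trans (ler_norm _))//.
by rewrite /t (bigD1 i)//= addrCA lerDl addr_ge0// s0.
Qed.

Lemma sub_tight_eq0 S x y i : tight S i -> S x -> S y -> dot (a i) (x - y) = 0.
Proof. by move=> /tightP ti Sx Sy; rewrite dotB !ti// subrr. Qed.

Lemma halfspaces_mid x y :
  halfspaces x -> halfspaces y -> halfspaces (2^-1 *: (x + y)).
Proof.
by move=> hx hy i; rewrite dotZ dotD; have := hx i; have := hy i; lra.
Qed.

(* By dimension, a facet is cut out by any inequality that is tight on it but
   not on the whole polyhedron. *)
Lemma facet_halfspaces F : facet halfspaces F ->
  exists j, F = halfspaces `&` [set x | dot (a j) x = b j].
Proof.
move=> [[c [delta [cP ->]]]] [k [Fne [UF dF dimF]]] [Pne [UP dP dimP]].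
set P := halfspaces in cP Fne dF Pne dP *.
set G := P `&` _ in Fne dF *.
have GP : G `<=` P by move=> x [].
have [z Gz zs] : exists2 z, G z & forall i, ~~ tight G i -> dot (a i) z < b i.
  apply: exists_slack_point => // x y [Px cx] [Py cy].
  split; first exact: halfspaces_mid.
  by rewrite /= dotZ dotD cx cy; lra.
(* Otherwise the face would be all of [P] and have the same dimension. *)
have [p Pp cp] : exists2 p, P p & dot c p < delta.
  apply: contrapT => nex; suff GE : G = P.
    move: dF; rewrite GE => /direction_uniq/(_ dP) UE.
    by move: dimF; rewrite UE dimP => /eqP; rewrite eqn_leq ltnn.
  apply/seteqP; split=> // x Px; split=> //=; apply/eqP.
  rewrite eq_le cP//= leNgt; apply/negP => cx; apply: nex; by exists x.
(* If every inequality tight on the face were tight on [P], a small step from [z] away from [p]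
   would stay in [P] and push [c] beyond [delta]. *)
have [j tj ntj] : exists2 j, tight G j & ~~ tight P j.
  apply: contrapT => nex.
  have tGP i : tight G i -> tight P i.
    by move=> tGi; apply: contrapT => /negP ntPi; apply: nex; exists i.
  have [e e0 eP] :=
    exists_slack_step (fun i => dot (a i) z) (fun i => dot (a i) (z - p)).
  have /cP : P (z + e *: (z - p)).
    move=> i; rewrite dotD dotZ; have [/tGP tPi|nti] := boolP (tight G i).
      by rewrite (sub_tight_eq0 tPi)//; [rewrite mulr0 addr0; case: Gz|case: Gz].
    by apply: eP; exact: zs.
  rewrite dotD dotZ dotB; have [_ /= ->] := Gz.
  by rewrite leNgt ltrDl mulr_gt0// subr_gt0.
exists j; apply/seteqP; split=> [x Gx|x [Px ajx]].
  by split; [exact: GP|exact: (tightP _ _ tj)].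
have [q Pq aq] : exists2 q, P q & dot (a j) q != b j.
  apply: contrapT => nex; move/tightP: ntj; apply=> q Pq.
  by apply/eqP; apply: contrapT => /negP aq; apply: nex; exists q.
have az : dot (a j) z = b j by exact: (tightP _ _ tj).
have Pz : P z by case: Gz.
have /dim_cap_lker_dot/(_ _) : q - z \in UP by apply: dP.1.
move=> /(_ (a j)); rewrite dotB az subr_eq0 => /(_ aq); rewrite dimP => -[kE].
(* The hyperplane of [j] lowers the dimension of [UP] by exactly one, as passing to the facet does,
   so this inclusion is an equality. *)
have UFsub : (UF <= UP :&: lker (dotlin (a j)))%VS.
  apply: dF.2 => x' y' Gx Gy; rewrite memv_cap mem_lker_dot.
  rewrite (sub_tight_eq0 tj)// eqxx andbT; apply: dP.1; exact: GP.
have UFE : UF = (UP :&: lker (dotlin (a j)))%VS.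
  by apply/eqP; rewrite eqEdim UFsub dimF -kE leqnn.
have : x - z \in UF.
  by rewrite UFE memv_cap mem_lker_dot dotB az ajx subrr eqxx andbT; apply: dP.1.
have /subvP UFc : (UF <= lker (dotlin c))%VS.
  apply: dF.2 => x' y' [_ cx] [_ cy].
  by rewrite mem_lker_dot dotB cx cy subrr.
move/UFc; rewrite mem_lker_dot dotB subr_eq0 => /eqP cx; split=> //=.
by rewrite cx; case: Gz.
Qed.

Lemma card_facet_halfspaces : (facet halfspaces #<= `I_#|I|)%card.
Proof.
pose Fi (i : I) := halfspaces `&` [set x | dot (a i) x = b i].
(* Indices are enumerated because [I_k] consists of naturals; the default [set0] is met only past
   the end of the list. *)
have sub : facet halfspaces `<=` (fun i : nat => oapp Fi set0 (ohead (drop i (enum I)))) @` `I_#|I|.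
  move=> F /facet_halfspaces[j ->]; exists (enum_rank j) => //=.
  rewrite (drop_nth j) ?nth_enum_rank//.
  by rewrite -cardE ltn_ord.
exact: card_le_trans (subset_card_le sub) (card_image_le _ _).
Qed.

(* Among the non-tight inequalities, a minimal subsystem J still describing
   the polyhedron inside its affine hull has one facet per inequality. *)
Lemma irredundant_facets : halfspaces !=set0 ->
  exists J : {set I},
    (forall x, (forall i, tight halfspaces i -> dot (a i) x = b i) ->
      (forall j, j \in J -> dot (a j) x <= b j) -> halfspaces x) /\
    exists2 Fj : I -> set V, (forall j, j \in J -> facet halfspaces (Fj j)) &
      {in J &, injective Fj}.
Proof.
move=> Pne; set P := halfspaces.
have [z Pz zs] : exists2 z, P z & forall i, ~~ tight P i -> dot (a i) z < b i.
  by apply: exists_slack_point => //; exact: halfspaces_mid.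
pose aff := [set x | forall i, tight P i -> dot (a i) x = b i].
have Paff x : P x -> aff x by move=> Px i /tightP; apply.
pose describes (J : {set I}) := `[< forall x, aff x ->
  (forall j, j \in J -> dot (a j) x <= b j) -> P x >].
have [J /minsetP[/asboolP JP Jmin]] : {J | minset describes J}.
  apply: ex_minset; exists [set: I]%SET; apply/asboolP => x _ xP i.
  exact: xP (finset.in_setT i).
pose Fj j := P `&` [set x | dot (a j) x = b j].
(* Each kept inequality has a point [p] of [P] tight for it alone within [J]; this gives both the
   dimension and the distinctness of the facets. *)
have JF j : j \in J -> exists p, [/\ Fj j p, dot (a j) z < b j &
    forall i, i \in J -> i != j -> dot (a i) p < b i].
  move=> jJ.
  have /asboolP nJ : ~~ describes (J :\ j)%SET.
    apply/negP => /Jmin/(_ (subsetDl _ _)) JE.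
    by move: jJ; rewrite -JE !inE eqxx.
  (* By minimality, dropping [j] admits a point [x] that violates only [j] among the inequalities of
     [J]. *)
  have [x [affx xJ]] : exists x, [/\ aff x,
      forall i, i \in J -> i != j -> dot (a i) x <= b i & ~~ (dot (a j) x <= b j)].
    apply: contrapT => nex; apply: nJ => x affx xJ.
    apply: JP => // i iJ; have [->|ij] := eqVneq i j; last first.
      by apply: xJ; rewrite !inE ij iJ.
    apply: contrapT => /negP xj; apply: nex; exists x; split=> // k kJ kj.
    by apply: xJ; rewrite !inE kj kJ.
  rewrite -ltNge => xj.
  have zj : dot (a j) z < b j.
    by apply: zs; apply/negP => /affx xjE; rewrite xjE ltxx in xj.
  have zx : 0 < dot (a j) x - dot (a j) z by lra.
  (* At parameter [l] the segment from the slack point [z] to [x] crosses the hyperplane of [j]; the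
     other inequalities of [J] stay strict because [l < 1]. *)
  pose l := (b j - dot (a j) z) / (dot (a j) x - dot (a j) z).
  have l0 : 0 < l by rewrite divr_gt0//; lra.
  have l1 : l < 1 by rewrite ltr_pdivrMr//; lra.
  pose p := z + l *: (x - z).
  have pE i : dot (a i) p = (1 - l) * dot (a i) z + l * dot (a i) x.
    by rewrite dotD dotZ dotB; ring.
  have pj : dot (a j) p = b j.
    by rewrite dotD dotZ dotB /l divfK ?gt_eqF//; ring.
  have affp : aff p.
    by move=> i ti; rewrite pE (Paff _ Pz i ti) (affx i ti); ring.
  have pJ i : i \in J -> i != j -> dot (a i) p < b i.
    (* A tight inequality cannot belong to the minimal [J], since it already holds on [aff]. *)
    move=> iJ ij; have := xJ i iJ ij; have [ti _|nti] := boolP (tight P i).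
      have /asboolP[] : ~~ describes (J :\ i)%SET.
        apply/negP => /Jmin/(_ (subsetDl _ _)) JE.
        by move: iJ; rewrite -JE !inE eqxx.
      move=> y affy yJ; apply: JP => // k kJ; have [->|ki] := eqVneq k i.
        by rewrite affy.
      by apply: yJ; rewrite !inE ki kJ.
    have := zs i nti; rewrite pE; nra.
  exists p; split=> //; split=> //; apply: JP => // i iJ.
  by have [->|ij] := eqVneq i j; [rewrite pj|rewrite ltW// pJ].
exists J; split=> //; exists Fj; last first.
  move=> i j iJ jJ Fij; apply/eqP/negPn/negP => ij.
  have [p [Fp _ pJ]] := JF j jJ; move: Fp; rewrite -Fij => -[_ /= pi].
  by have := pJ i iJ ij; rewrite pi ltxx.
move=> j jJ; have [p [[Pp pj] zj pJ]] := JF j jJ; split.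
  by exists (a j), (b j); split=> // x; apply.
pose U := (\bigcap_(i | tight P i) lker (dotlin (a i)))%VS.
have memU v : reflect (forall i, tight P i -> dot (a i) v = 0) (v \in U).
  rewrite memvE; apply: (iffP subv_bigcapP) => vU i ti; have := vU i ti.
    by rewrite -memvE mem_lker_dot => /eqP.
  by move=> vi; rewrite -memvE mem_lker_dot vi.
have dP : direction P U.
  apply: (directionP Pz) => [x y Px Py|v /memU vU].
    by apply/memU => i ti; exact: (sub_tight_eq0 ti).
  have [e e0 eP] := exists_slack_step (fun i => dot (a i) z) (fun i => dot (a i) v).
  exists e => // i; rewrite dotD dotZ; have [ti|nti] := boolP (tight P i).
    by rewrite vU// mulr0 addr0 Pz.
  exact/eP/zs.
have dF : direction (Fj j) (U :&: lker (dotlin (a j)))%VS.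
  apply: (@directionP _ p) => //= [x y [Px /= xj] [Py /= yj]|v].
    rewrite memv_cap mem_lker_dot dotB xj yj subrr eqxx andbT.
    by apply/memU => i ti; exact: (sub_tight_eq0 ti).
  rewrite memv_cap mem_lker_dot => /andP[/memU vU /eqP vj].
  have [e e0 eP] := exists_slack_step (fun i => dot (a i) p) (fun i => dot (a i) v).
  exists e => //; split; last by rewrite /= dotD dotZ vj mulr0 addr0.
  apply: JP => [i ti|i iJ]; rewrite dotD dotZ.
    by rewrite vU// mulr0 addr0 Paff.
  have [->|ij] := eqVneq i j; first by rewrite pj vj mulr0 addr0.
  by apply: eP; exact: pJ.
have /dim_cap_lker_dot : z - p \in U by apply: dP.1.
move=> /(_ (a j)); rewrite dotB pj subr_eq0 lt_eqF// => /(_ isT) dimU.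
exists (\dim (U :&: lker (dotlin (a j)))).
  by split; [exists p|exists (U :&: lker (dotlin (a j)))%VS].
by split; [exists z|exists U].
Qed.

End Polyhedra.

(** * Bounding the relaxation complexity by counting inequalities and hidden points *)

Section RelaxationBounds.
Local Open Scope classical_set_scope.
Variables (R : realType) (E : finType).
Local Notation V := {ffun E -> R^o}.
Implicit Types (X P : set V) (x y : V).

Lemma sub_conv_hull X : X `<=` conv_hull X.
Proof. exact: sub_gen_smallest. Qed.

Lemma conv_hull_dot_le X (c : V) (d : R) y :
  (forall x, X x -> dot c x <= d) -> conv_hull X y -> dot c y <= d.
Proof.
move=> Xd; apply: (@smallest_sub _ _ _ [set x : V | dot c x <= d]) => // u v l.
rewrite !inE/= => ud vd.
rewrite -[conv l u v]/(l%:num *: u + (1 - l%:num) *: v) dotD !dotZ.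
have : 0 <= l%:num <= 1 by rewrite ge0 le1.
by case/andP; nra.
Qed.

Lemma dotNl (a x : V) : dot (- a) x = - dot a x.
Proof. by rewrite /dot -sumrN; apply: eq_bigr => e _; rewrite ffunE mulNr. Qed.

Lemma dot_char_vec (F : {set E}) x : dot (char_vec R F) x = \sum_(e in F) x e.
Proof.
rewrite /dot [RHS]big_mkcond; apply: eq_bigr => e _; rewrite ffunE.
by case: (e \in F); rewrite ?mul1r ?mul0r.
Qed.

Lemma dot_char_vec2 (F G : {set E}) :
  dot (char_vec R F) (char_vec R G) = #|F :&: G|%:R.
Proof.
rewrite dot_char_vec -sum1_card natr_sum.
rewrite (eq_bigl (fun e => (e \in F) && (e \in G))) => [|e]; last by rewrite inE.
by rewrite big_mkcondr; apply: eq_bigr => e _; rewrite ffunE; case: ifP.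
Qed.

Lemma char_vec_integer (F : {set E}) : integer_points (char_vec R F).
Proof. by move=> e; rewrite ffunE; case: (e \in F); rewrite ?rpred0 ?rpred1. Qed.

Lemma integer_box_char_vec x : integer_points x ->
  (forall e, 0 <= x e <= 1) -> exists F, x = char_vec R F.
Proof.
move=> xint x01; exists [set e | x e == 1]%SET; apply/ffunP => e.
rewrite ffunE inE; have /intrP[m xm] := xint e; have := x01 e; rewrite xm.
rewrite ler0z lerz1 -[_ == 1 :> R]/(_ == 1%:~R :> R) eqr_int.
have [->|/eqP m1] := eqVneq m 1; first by [].
move=> /andP[m0 m1le]; suff -> : m = 0 by [].
by lia.
Qed.

(** The box constraints force integer points to be characteristic vectors, among which the given
    system selects exactly those of [H]; the two copies of [E] count lower and upper bounds. *)
Lemma rc_le_card (H : {set E} -> Prop) (I : finType) (a : I -> V) (b : I -> R) :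
  (forall F, H F <-> forall i, dot (a i) (char_vec R F) <= b i) ->
  (rc [set char_vec R F | F in [set F | H F]] <=
   (#|E| + #|E| + #|I|)%:R%:E)%E.
Proof.
move=> HE; set X := [set _ | _ in _].
pose a' (i : E + E + I) : V := match i with
  | inl (inl e) => - char_vec R [set e]%SET
  | inl (inr e) => char_vec R [set e]%SET
  | inr i => a i end.
pose b' (i : E + E + I) : R := match i with
  | inl (inl e) => 0 | inl (inr e) => 1 | inr i => b i end.
set P := halfspaces a' b'.
have XP : X `<=` P.
  move=> _ [F /HE HF <-] [[e|e]|i]//=; rewrite ?dotNl dot_char_vec2 ?oppr_le0//.
  by rewrite (ler_nat R _ 1) (leq_trans (subset_leq_card (subsetIl _ _)))// cards1.
have PX : P `&` @integer_points R E `<=` X.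
  move=> x [Px xint]; have [F xF] : exists F, x = char_vec R F.
    apply: integer_box_char_vec => // e.
    have := Px (inl (inl e)); have := Px (inl (inr e)).
    by rewrite /= dotNl oppr_le0 dot_char_vec finset.big_set1 => -> ->.
  by exists F => //; apply/HE => i; have := Px (inr i); rewrite xF.
have relP : relaxation X P.
  split; first exact: polyhedron_halfspaces.
  apply/seteqP; split=> x [Sx xint]; split=> //.
    by apply: sub_conv_hull; exact: PX.
  by move=> i; move: Sx; apply: conv_hull_dot_le => y /XP.
have Pcard := card_facet_halfspaces a' b'; rewrite -/P in Pcard.
have /finite_setP[k Pk] : finite_set (facet P).
  by apply: card_le_finite Pcard _; exact: finite_II.
apply: (@le_trans _ _ k%:R%:E).
  by apply: ereal_inf_lbound; exists k => //; exists P.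
move: Pk => /card_eqPle[_ /card_le_trans/(_ Pcard)].
by rewrite card_le_II !card_sum lee_fin ler_nat.
Qed.

(* Two points of Y cannot violate the same inequality of a relaxation, because
   their midpoint is also the midpoint of two points of X; three points suffice
   to write every point of Y as an affine combination of points of X, so each of
   them violates an inequality that defines a facet. *)
Lemma rc_ge_card (X : set V) (T : finType) (Y : T -> V) :
  (2 < #|T|)%N ->
  X `<=` @integer_points R E -> (forall t, integer_points (Y t)) ->
  (forall t, exists c d, (forall x, X x -> dot c x <= d) /\ d < dot c (Y t)) ->
  (forall t t', t != t' -> exists x x', [/\ X x, X x' & Y t + Y t' = x + x']) ->
  (#|T|%:R%:E <= rc X)%E.
Proof.
move=> T2 Xint Yint Ysep Ymid; apply: le_ereal_inf_tmp => _ [k [P [polP relP]] Pk <-].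
rewrite lee_fin ler_nat.
have XP : X `<=` P.
  move=> x Xx; suff : (P `&` @integer_points R E) x by case.
  by rewrite relP; split; [exact: sub_conv_hull|exact: Xint].
(* An integer point of [P] would lie in the convex hull, which the separating inequality forbids. *)
have nPY t : ~ P (Y t).
  move=> PY; have [c [d [cX cY]]] := Ysep t.
  have [convY _] : (conv_hull X `&` @integer_points R E) (Y t) by rewrite -relP.
  by have := conv_hull_dot_le cX convY; rewrite leNgt cY.
have [m [a [b PE]]] := polP; have {}PE : P = halfspaces a b by [].
have Pne : halfspaces a b !=set0.
  have /card_gt1P[t [t' [_ _ /Ymid[x [_ [/XP Px _ _]]]]]] := ltnW T2.
  by exists x; rewrite -PE.
have [J [JP [Fj Ffacet Finj]]] := irredundant_facets Pne.
rewrite -PE in JP Ffacet.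
have Jk : (#|J| <= k)%N.
  have /pcard_leP/injfunPex[g gk ginj] : (facet P #<= `I_k)%card.
    by case/card_eqPle: Pk.
  suff : (size [seq g (Fj j) | j <- enum J] <= size (iota 0 k))%N.
    by rewrite size_map -cardE size_iota.
  apply: uniq_leq_size.
    rewrite map_inj_in_uniq ?enum_uniq// => i j; rewrite !mem_enum => iJ jJ.
    by move/ginj => gij; apply: Finj => //; apply: gij; rewrite inE; exact: Ffacet.
  move=> x /mapP[j]; rewrite mem_enum mem_iota => /Ffacet jF -> /=.
  exact: gk.
(* The pairwise sums of the values of [a i] at [Y t], [Y u] and [Y v] all equal [2 * b i], which
   determines each value. *)
have Yaff t i : tight a b P i -> dot (a i) (Y t) = b i.
  move=> /tightP ti; have /card_gt1P[u [v [ut vt uv]]] : (1 < #|predC1 t|)%N.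
    by rewrite cardC1; lia.
  rewrite !inE in ut vt.
  have mid p q : p != q -> dot (a i) (Y p) + dot (a i) (Y q) = b i + b i.
    move=> /Ymid[x [x' [/XP Px /XP Px' pq]]].
    by rewrite -dotD pq dotD !ti.
  clear relP PE; have := mid _ _ ut; have := mid _ _ vt; have := mid _ _ uv.
  lra.
(* [Y t] satisfies all tight inequalities with equality but lies outside [P], so it must violate an
   inequality kept in [J]. *)
have Yviol t : exists j, (j \in J) && (b j < dot (a j) (Y t)).
  apply: contrapT => nex; apply: (nPY t); apply: JP => [i|j jJ]; first exact: Yaff.
  by rewrite leNgt; apply/negP => jY; apply: nex; exists j; rewrite jJ.
pose f t := xchoose (Yviol t).
have fP t : (f t \in J) /\ b (f t) < dot (a (f t)) (Y t).
  by have /andP := xchooseP (Yviol t).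
have finj : injective f.
  move=> t t' ftt'; apply/eqP/negPn/negP => tt'.
  have [x [x' [/XP + /XP + /(congr1 (dot (a (f t)) : _ -> R))]]] := Ymid _ _ tt'.
  rewrite PE => /(_ (f t)) xf /(_ (f t)) xf'; rewrite !dotD.
  by have := (fP t).2; have := (fP t').2; clear relP PE; rewrite -ftt'; lra.
apply: leq_trans Jk; rewrite -cardsT -(card_imset _ finj).
by apply/subset_leq_card/fintype.subsetP => _ /imsetP[t _ ->]; exact: (fP t).1.
Qed.

End RelaxationBounds.

(** * Cyclic orders and cycles in finite graphs *)

Section CyclicTuples.

Lemma next_closed_full n (c : n.-tuple 'I_n) (S : {set 'I_n}) v :
  uniq c -> (forall u, u \in S -> next c u \in S) -> v \in S -> S = [set: 'I_n].
Proof.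
move=> Uc Sc vS.
have cT u : u \in c.
  by rewrite (subset_cardP _ (subset_predT _)) // (card_uniqP Uc) size_tuple card_ord.
apply/setP => w; rewrite inE.
have : fconnect (next c) v w by rewrite (fconnect_cycle (cycle_next Uc) (cT v)).
by move/iter_findex <-; elim: (findex _ _ _) => //= k; apply: Sc.
Qed.

(** The hypothesis applied to the nodes reachable from [v] yields a single orbit, and applied to the
    image of [f] yields surjectivity, hence injectivity. *)
Lemma exists_cyclic_tuple n (f : 'I_n -> 'I_n) : (0 < n)%N ->
  (forall S : {set 'I_n}, (forall v, v \in S -> f v \in S) ->
    S = finset.set0 \/ S = [set: 'I_n]) ->
  exists2 c : n.-tuple 'I_n, uniq c & forall v, next c v = f v.
Proof.
move=> n0 fS; pose v0 := Ordinal n0.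
have con v w : fconnect f v w.
  have [|/setP/(_ v)|/setP/(_ w)] := fS [set w | fconnect f v w]%SET.
  - move=> u; rewrite !inE => vu; exact: connect_trans vu (fconnect1 f u).
  - by rewrite !inE connect0.
  - by rewrite !inE.
have finj : injective f.
  have [|/setP/(_ (f v0))|fT] := fS (f @: [set: 'I_n])%SET.
  - by move=> v _; rewrite imset_f.
  - by rewrite imset_f ?inE.
  - have fin : {in [set: 'I_n] &, injective f} by apply/imset_injP; rewrite fT.
    by move=> x y; apply: fin; rewrite inE.
have so : size (orbit f v0) == n.
  rewrite size_orbit /order (eq_card (B := 'I_n)); first by rewrite card_ord.
  by move=> w; rewrite -[LHS]/(fconnect f v0 w) con.
exists (Tuple so); first exact: orbit_uniq.
move=> v; have vo : v \in orbit f v0 by rewrite -fconnect_orbit.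
by have /eqP := next_cycle (cycle_orbit finj v0) vo.
Qed.

Lemma next_next_neq (T : eqType) (p : seq T) x :
  uniq p -> (2 < size p)%N -> x \in p -> next p (next p x) != x.
Proof.
move=> Up p2 xp; have [i s sE] := rot_to xp.
rewrite -!(next_rot i Up) sE.
have : uniq (x :: s) by rewrite -sE rot_uniq.
have : (2 < size (x :: s))%N by rewrite -sE size_rot.
case: s {sE} => [|y [|z s]]//= _ /andP[xs /andP[ys _]].
have yx : y == x = false by move: xs; rewrite inE eq_sym; case: eqP.
rewrite eqxx yx; rewrite !inE in xs.
by rewrite eqxx; move: xs; rewrite !negb_or (eq_sym z) => /and3P[].
Qed.

(* Extending a simple path at its head until the new neighbour of the head is
   already on the path closes a cycle. *)
Lemma exists_simple_cycle (T : finType) (e : rel T) (x0 : T) :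
  symmetric e -> irreflexive e -> (forall v u, exists2 w, w != u & e v w) ->
  exists p, [/\ cycle e p, uniq p & (2 < size p)%N].
Proof.
move=> esym eirr e2.
(* Induction on a bound [m] for the number of vertices outside [q]; it cannot be 0, since [y] itself
   is not in [q]. *)
suff ext m y q : (#|T| - size q <= m)%N -> path e y q -> uniq (y :: q) ->
    exists p, [/\ cycle e p, uniq p & (2 < size p)%N].
  by apply: (ext #|T| x0 [::]) => //=; rewrite subn0.
elim: m y q => [|m IH] y q qm yq Uyq.
  have : (size (y :: q) <= #|T|)%N.
    by rewrite -(card_uniqP Uyq) max_card.
  by rewrite /= ltnNge -subn_eq0 -leqn0 qm.
have grow z : e y z -> z \notin y :: q ->
    exists p, [/\ cycle e p, uniq p & (2 < size p)%N].
  move=> yz zq; apply: (IH z (y :: q)).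
  - by move: qm => /=; lia.
  - by rewrite /= esym yz.
  - by rewrite cons_uniq zq.
case: q => [|w q'] in qm yq Uyq grow *.
  have [z zy yz] := e2 y y; apply: grow yz _.
  by rewrite inE.
(* Taking a neighbour [z] other than [w] ensures that closing up at [z] gives a cycle of at least
   three vertices. *)
have [z zw yz] := e2 y w.
have zy : z != y by apply: contraTneq yz => ->; rewrite eirr.
have [zq|zq] := boolP (z \in q'); last first.
  by apply: grow yz _; rewrite !inE (negPf zy) (negPf zw).
case/splitPr: zq => q1 q2 in qm yq Uyq grow *.
exists (y :: w :: rcons q1 z); split=> //.
- move: yq => /= /andP[-> /=]; rewrite cat_path /= rcons_path last_rcons.
  by rewrite rcons_path (esym z) yz => /and3P[-> -> _].
- move: Uyq; rewrite -cat_rcons -!cat_cons cat_uniq => /andP[]//.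
- by rewrite /= size_rcons.
Qed.

End CyclicTuples.

(** * Directed hamiltonian cycles described by degrees and cuts *)

Section DirectedCycles.
Variable n : nat.
Implicit Types (F : {set darc n}) (S : {set 'I_n}).

Definition out_arcs (v : 'I_n) : {set darc n} := [set a : darc n | (val a).1 == v].

Definition dcut S : {set darc n} := [set a : darc n | ((val a).1 \in S) && ((val a).2 \notin S)].

Lemma darcP (v w : 'I_n) : v != w -> exists a : darc n, val a = (v, w).
Proof. by move=> vw; exists (exist _ (v, w) vw). Qed.

(** Cuts of singletons give every node an outgoing arc, so with the degree bound [F] is the graph of
    a map; the cuts then say that no proper nonempty set is closed under it. *)
Lemma directed_hamiltonian_cycleP F : (1 < n)%N ->
  directed_hamiltonian_cycle F <->
  (forall v, #|out_arcs v :&: F| <= 1)%N /\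
  (forall S, S != finset.set0 -> S != [set: 'I_n] -> 0 < #|dcut S :&: F|)%N.
Proof.
move=> n1; split=> [[_ [c Uc ->]]|[out cut]].
  split=> [v|S /set0Pn[v vS] ST].
    apply/card_le1_eqP => a a'; rewrite !inE.
    move=> /andP[/eqP av /eqP a2] /andP[/eqP av' /eqP a2'].
    by apply/val_inj/eqP; rewrite -pair_eqE /pair_eq a2 a2' av av' !eqxx.
  have [u uS nuS] : exists2 u, u \in S & next c u \notin S.
    apply/exists_inP; apply: contraNT ST => /exists_inPn Sc.
    by apply/eqP; apply: (next_closed_full Uc _ vS) => u /Sc; rewrite negbK.
  have [a aE] : exists a : darc n, val a = (u, next c u).
    by apply: darcP; apply: contraNneq nuS => <-.
  by apply/card_gt0P; exists a; rewrite !inE aE uS nuS eqxx.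
have succ v : exists a, a \in out_arcs v :&: F.
  have : (0 < #|dcut [set v] :&: F|)%N.
    apply: cut; first by apply/set0Pn; exists v; rewrite inE.
    apply/negP => /eqP/(congr1 (fun A : {set 'I_n} => #|A|)).
    by rewrite cards1 cardsT card_ord => n1'; rewrite -n1' in n1.
  by move=> /card_gt0P[a]; rewrite !inE => /andP[/andP[av _] aF]; exists a; rewrite !inE av.
pose f v := (val (xchoose (succ v))).2.
have fP a : (a \in F) = ((val a).2 == f (val a).1).
  have := xchooseP (succ (val a).1); rewrite /f.
  set a' := xchoose _; rewrite !inE => /andP[/eqP a1 a'F].
  apply/idP/eqP => [aF|a2].
    have /card_le1_eqP/(_ a a') := out (val a).1.
    by rewrite !inE a1 eqxx aF a'F => ->.
  suff -> : a = a' by [].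
  by apply/val_inj/eqP; rewrite -pair_eqE /pair_eq a2 a1 !eqxx.
split=> //; have [||c Uc cf] := @exists_cyclic_tuple n f; first exact: ltnW.
  move=> S Sf; have [->|S0] := eqVneq S finset.set0; first by left.
  have [->|ST] := eqVneq S [set: 'I_n]; first by right.
  have /card_gt0P[a] := cut S S0 ST.
  rewrite !inE fP => /andP[/andP[a1 a2] /eqP a2f].
  by rewrite a2f Sf in a2.
by exists c => //; apply/setP => a; rewrite inE fP cf.
Qed.

End DirectedCycles.

(** * Undirected hamiltonian cycles described by degrees and cuts *)

Section UndirectedCycles.
Variable n : nat.
Implicit Types (F : {set edge n}) (S : {set 'I_n}).

Definition incident (v : 'I_n) : {set edge n} := [set e : edge n | v \in val e].

Definition cut S : {set edge n} :=
  [set e : edge n | [exists v in S, exists w in ~: S, val e == [set v; w]]].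

Lemma edgeP (v w : 'I_n) : v != w -> exists e : edge n, val e = [set v; w].
Proof.
move=> vw; have e2 : #|[set v; w]| == 2 by rewrite cards2 vw.
by exists (exist _ [set v; w] e2).
Qed.

Lemma eq_set2 (T : finType) (u v x y : T) : [set u; v] = [set x; y] ->
  (u = x /\ v = y) \/ (u = y /\ v = x).
Proof.
move=> E; have := set21 u v; have := set22 u v; rewrite E !inE.
have := set21 x y; have := set22 x y; rewrite -E !inE.
do 4 move=> /orP[] /eqP ?; subst; by [left|right].
Qed.

Definition adjacent F (v w : 'I_n) := [exists e in F, val e == [set v; w]].

Lemma adjacentP F v w :
  reflect (exists2 e, e \in F & val e = [set v; w]) (adjacent F v w).
Proof.
by apply: (iffP exists_inP) => -[e eF /eqP eE]; exists e => //; apply/eqP.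
Qed.

Lemma adjacent_sym F : symmetric (adjacent F).
Proof. by move=> v w; apply: eq_existsb => e; rewrite finset.setUC. Qed.

Lemma adjacent_neq F v w : adjacent F v w -> v != w.
Proof.
move=> /adjacentP[e eF eE]; have := valP e; rewrite /= eE cards2.
by case: (v == w).
Qed.

Lemma adjacent_irr F : irreflexive (adjacent F).
Proof. by move=> v; apply/negbTE/negP => /adjacent_neq; rewrite eqxx. Qed.

Lemma mem_edge_adjacent F e v : e \in F -> v \in val e ->
  exists2 w, adjacent F v w & val e = [set v; w].
Proof.
move=> eF ve; have /cards2P[x [y [xy eE]]] := valP e.
suff [w ew] : exists w, val e = [set v; w].
  by exists w => //; apply/adjacentP; exists e.
by move: ve; rewrite eE !inE => /orP[/eqP->|/eqP->];
  [exists y|exists x; rewrite finset.setUC].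
Qed.

Lemma card_incident F v :
  #|incident v :&: F| = #|[set w | adjacent F v w]|.
Proof.
rewrite -(card_imset _ val_inj) -(card_in_imset (f := fun w => [set v; w])).
  apply: eq_card => A; apply/imsetP/imsetP => [[e]|[w]].
    rewrite !inE => /andP[ve eF] ->.
    by have [w vw ew] := mem_edge_adjacent eF ve; exists w; rewrite ?inE.
  rewrite inE => /adjacentP[e eF eE] ->; exists e => //.
  by rewrite !inE eE set21.
move=> w w'; rewrite !inE => /adjacent_neq vw _ /eq_set2[[]//|[vw' wv]].
by rewrite wv eqxx in vw.
Qed.

(** Degree 2 everywhere produces a simple cycle; since it uses both edges at each of its nodes, no
    edge of [F] leaves it, and the cut constraints make it spanning. *)
Lemma hamiltonian_cycleP F : (2 < n)%N ->
  hamiltonian_cycle F <->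
  (forall v, #|incident v :&: F| = 2)%N /\
  (forall S, S != finset.set0 -> S != [set: 'I_n] -> 0 < #|cut S :&: F|)%N.
Proof.
move=> n2; split=> [[_ [c Uc ->]]|[deg cutF]].
  set F' := [set _ | _].
  have cT u : u \in c.
    by rewrite (subset_cardP _ (subset_predT _)) // (card_uniqP Uc) size_tuple card_ord.
  have nn u : next c (next c u) != u by rewrite next_next_neq ?size_tuple.
  have nu u : next c u != u.
    by apply: contraNneq (nn u) => nuE; rewrite !nuE.
  split=> [v|S /set0Pn[v vS] ST].
    rewrite card_incident.
    have -> : [set w | adjacent F' v w] = [set next c v; prev c v].
      apply/setP => w; rewrite !inE; apply/adjacentP/orP => [[e]|].
        rewrite inE => /existsP[u /eqP ->] /eq_set2[[-> <-]|[<- <-]].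
          by left.
        by right; rewrite prev_next.
      have adjn u : exists2 e, e \in F' & val e = [set u; next c u].
        have /edgeP[e eE] : u != next c u by rewrite eq_sym.
        by exists e => //; rewrite inE; apply/existsP; exists u; rewrite eE.
      case=> /eqP->; first by have [e eF eE] := adjn v; exists e.
      have [e eF eE] := adjn (prev c v); exists e => //.
      by rewrite eE next_prev// finset.setUC.
    rewrite cards2; suff -> : next c v != prev c v by [].
    by apply: contraNneq (nn (prev c v)) => E; rewrite next_prev// E.
  have [u uS nuS] : exists2 u, u \in S & next c u \notin S.
    apply/exists_inP; apply: contraNT ST => /exists_inPn Sc.
    by apply/eqP; apply: (next_closed_full Uc _ vS) => u /Sc; rewrite negbK.
  have /edgeP[e eE] : u != next c u by rewrite eq_sym.
  apply/card_gt0P; exists e; rewrite !inE; apply/andP; split; last first.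
    by apply/existsP; exists u; rewrite eE.
  apply/exists_inP; exists u => //; apply/exists_inP; exists (next c u).
    by rewrite inE.
  by rewrite eE.
have nbr2 v : #|[set w | adjacent F v w]| = 2 by rewrite -card_incident.
have other v u : exists2 w, w != u & adjacent F v w.
  have : (0 < #|[set w | adjacent F v w] :\ u|)%N.
    by have := cardsD1 u [set w | adjacent F v w]; rewrite nbr2; case: (_ \in _) => /=; lia.
  by move=> /card_gt0P[w]; rewrite !inE => /andP[wu vw]; exists w.
have [p [cp Up p2]] := exists_simple_cycle (Ordinal (ltn_trans (ltn0Sn 1) n2))
  (adjacent_sym F) (adjacent_irr F) other.
have nbrE v : v \in p -> [set w | adjacent F v w] = [set next p v; prev p v].
  move=> vp; apply/esym/eqP; rewrite eqEcard nbr2; apply/andP; split.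
    apply/fintype.subsetP => w; rewrite !inE => /orP[] /eqP ->.
      exact: next_cycle cp vp.
    by rewrite adjacent_sym; exact: prev_cycle cp vp.
  rewrite cards2; suff -> : next p v != prev p v by [].
  apply: contraNneq (next_next_neq Up p2 (_ : prev p v \in p)) => [E|].
    by rewrite next_prev// E.
  by rewrite mem_prev.
have pT v : v \in p.
  suff : [set v in p] = [set: 'I_n] by move/setP/(_ v); rewrite !inE.
  apply/eqP/negPn/negP => pnT.
  have p0 : [set v in p] != finset.set0.
    by case: (p) p2 => // x q _; apply/set0Pn; exists x; rewrite !inE eqxx.
  have /card_gt0P[e] := cutF _ p0 pnT.
  rewrite !inE => /andP[/exists_inP[x + /exists_inP[y + /eqP eE]] eF].
  rewrite !inE => xp /negP; apply.
  have : y \in [set w | adjacent F x w].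
    by rewrite inE; apply/adjacentP; exists e.
  by rewrite nbrE// !inE => /orP[]/eqP->; rewrite ?mem_next ?mem_prev.
have sp : size p == n.
  rewrite -(card_uniqP Up) (eq_card (B := 'I_n)); first by rewrite card_ord.
  by move=> v; rewrite pT.
split=> //; exists (Tuple sp) => //; apply/setP => e; rewrite inE.
apply/idP/existsP => [eF|[v /eqP eE]].
  have /cards2P[x [y [xy eE]]] := valP e.
  have : y \in [set w | adjacent F x w].
    by rewrite inE; apply/adjacentP; exists e.
  rewrite nbrE// !inE => /orP[]/eqP yE; first by exists x; rewrite eE yE.
  by exists y; rewrite eE yE next_prev// finset.setUC.
have : next p v \in [set w | adjacent F v w] by rewrite nbrE// set21.
rewrite inE => /adjacentP[e' e'F e'E].
by suff -> : e = e' by []; apply/val_inj; rewrite eE e'E.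
Qed.

End UndirectedCycles.

(** * Switched successor maps and the parity of their orbits *)

Section Switches.
Local Open Scope nat_scope.
Variables (n' l : nat).
Local Notation n := n'.+1.
Hypothesis ln : (n = l.*2 \/ n = l.*2.+1)%N.
Hypothesis l4 : (4 <= l)%N.
Implicit Types (b : nat -> bool) (v : 'I_n).

(* With b i set, the successors of the nodes i and l + i are exchanged. *)
Definition switch b (k : nat) : nat :=
  if (k < l)%N then (if b k then l + k else k)%N
  else if (k < l.*2)%N then (if b (k - l) then k - l else k)%N else k.

Lemma switch_lt b k : (k < n)%N -> (switch b k < n)%N.
Proof.
rewrite /switch => kn; case: ifP => kl; first by case: ifP => _; lia.
by case: ifP => kl2 //; case: ifP => _ //; lia.
Qed.

Lemma switchK b : involutive (switch b).
Proof.
clear ln l4; move=> k; rewrite /switch.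
have [kl|lk] := ltnP k l.
  case bk: (b k); last by rewrite kl bk.
  by rewrite ltnNge leq_addr /= addKn bk -addnn ltn_add2l kl.
have [kl2|lk2] := ltnP k l.*2; last by rewrite !ltnNge lk lk2.
case bk: (b (k - l)).
  have -> : (k - l < l)%N by lia.
  by rewrite bk; lia.
by rewrite ltnNge lk kl2 bk.
Qed.

Lemma switchP b k : switch b k = k \/ (k < l /\ switch b k = k + l) \/
  (l <= k < l.*2 /\ switch b k = k - l).
Proof.
rewrite /switch; case: (ltnP k l) => kl.
  by case: (b k); [right; left; rewrite addnC|left].
case: (ltnP k l.*2) => kl2; last by left.
by case: (b (k - l)); [right; right|left].
Qed.

Lemma wrapP k : (k = n' /\ (if k == n' then 0 else k.+1) = 0) \/
  (k <> n' /\ (if k == n' then 0 else k.+1) = k.+1).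
Proof. by case: eqP; [left|right]. Qed.

(** [ordS] is the step along the circle; when [n] is odd, node [l.*2] always keeps its circular
    successor. *)
Definition succ b v : 'I_n := ordS (inord (switch b v)).

Lemma val_succ b v :
  val (succ b v) = (if switch b v == n' then 0 else (switch b v).+1)%N.
Proof.
rewrite /= inordK ?switch_lt//; have := switch_lt b (ltn_ord v).
rewrite ltnS leq_eqVlt; case: eqP => [->|_] /= ltn; first exact: modnn.
by rewrite modn_small.
Qed.

Lemma succ_inj b : injective (succ b).
Proof.
move=> v w /(can_inj (@ordSK _)) /(congr1 val) /=.
rewrite !inordK ?switch_lt// => /(can_inj (switchK b)).
exact: val_inj.
Qed.

(** Each step adds 1, [1 + l] or [1 - l] modulo [n], and no sum of two of these is divisible by [n]
    when [l >= 4]. *)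
Lemma succ_succ_neq b v : succ b (succ b v) != v.
Proof.
apply/eqP => /(congr1 val); rewrite !val_succ; have := ltn_ord v.
rewrite -[nat_of_ord v]/(val v); move: (val v) => x xn.
have := wrapP (switch b x); have := switchP b x; set y := switch b x.
set y' := (if y == n' then 0 else y.+1) => xy yy'.
have := wrapP (switch b y'); have := switchP b y'; set z := switch b y'.
set z' := (if z == n' then 0 else z.+1).
by clearbody y y' z z'; lia.
Qed.

Definition succ_perm b : {perm 'I_n} := perm (@succ_inj b).

Lemma succ_permE b v : succ_perm b v = succ b v.
Proof. by rewrite permE. Qed.

Definition odd_orbits b := odd #|porbits (succ_perm b)|.

Definition toggle i b : nat -> bool := fun k => (k == i) (+) b k.

Lemma odd_orbits_toggle b i : (i < l)%N ->
  odd_orbits (toggle i b) = ~~ odd_orbits b.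
Proof.
move=> il; pose x : 'I_n := inord i; pose y : 'I_n := inord (l + i).
have xE : val x = i by rewrite /= inordK//; lia.
have yE : val y = (l + i)%N by rewrite /= inordK//; lia.
have xy : x != y by apply/eqP => /(congr1 val); rewrite xE yE; lia.
have -> : odd_orbits (toggle i b) = odd #|porbits (tperm x y * succ_perm b)%g|.
  rewrite /odd_orbits; congr (odd #|porbits _|); apply/permP => v.
  rewrite permM !succ_permE /succ; congr (ordS (inord _)).
  have swx : switch b x = if b i then (l + i)%N else i by rewrite /switch xE il.
  have swy : switch b y = if b i then i else (l + i)%N.
    rewrite /switch yE ltnNge leq_addr/= addKn.
    by have -> : (l + i < l.*2)%N by lia.
  have [->|->|vx vy] := tpermP x y v.
  - by rewrite swy /switch xE il /toggle eqxx; case: (b i).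
  - rewrite swx /switch yE ltnNge leq_addr/= addKn /toggle eqxx.
    have -> : (l + i < l.*2)%N by lia.
    by case: (b i).
  - have vi : (v : nat) != i by apply: contra_notN vx => /eqP vE; apply/val_inj; rewrite xE.
    have vli : (v : nat) != l + i.
      by apply: contra_notN vy => /eqP vE; apply/val_inj; rewrite yE.
    rewrite /switch /toggle (negPf vi); case: ltnP => vl //.
    by have -> : (v - l == i)%N = false by move: vli; lia.
(* The sign of a permutation is the parity of [n] plus that of the number of its orbits, so the
   fixed term [odd #|'I_n|] cancels. *)
have := odd_mul_tperm x y (succ_perm b); rewrite xy /odd_perm => E.
by rewrite /odd_orbits -[LHS](addKb (odd #|'I_n|)) E; do 2 case: odd.
Qed.

(** At the two affected nodes only bit [i] counts, so the complement of [b] can stand for the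
    toggled map there. *)
Lemma succ_toggle b i v : (i < l)%N ->
  succ (toggle i b) v = if (v == i :> nat) || (v == l + i :> nat)
    then succ (fun k => ~~ b k) v else succ b v.
Proof.
clear ln l4; move=> il; case: ifP => vi; rewrite /succ; congr (ordS (inord _));
  rewrite /switch /toggle.
- case/orP: vi => /eqP ->; first by rewrite il eqxx.
  by rewrite ltnNge leq_addr/= addKn eqxx.
- move/norP: (negbT vi) => [vi1 vi2]; rewrite (negPf vi1).
  case: ltnP => vl //.
  by have -> : (v - l == i)%N = false by move: vi2; lia.
Qed.

(** As [b] and [b'] disagree at [i], toggling exchanges their successors at the two affected nodes
    and changes nothing elsewhere. The function [g] covers arcs and edges alike. *)
Lemma succ_toggle2 (V : nmodType) (g : 'I_n -> V) b b' i v : (i < l)%N ->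
  b i != b' i ->
  (g (succ b v) + g (succ b' v) =
   g (succ (toggle i b) v) + g (succ (toggle i b') v))%R.
Proof.
clear ln l4; move=> il bb'; rewrite !succ_toggle//; case: ifP => // vi.
have sE (c c' : nat -> bool) : c i = c' i -> succ c v = succ c' v.
  move=> cc'; rewrite /succ; congr (ordS (inord _)); rewrite /switch.
  case/orP: vi => /eqP ->; first by rewrite il cc'.
  by rewrite ltnNge leq_addr/= addKn cc'.
have bN : b i = ~~ b' i by move: bb'; case: (b i); case: (b' i).
rewrite addrC; congr (g _ + g _)%R; apply: sE; rewrite bN ?negbK//.
Qed.

Lemma closed_meets_base b (S : {set 'I_n}) v :
  (forall u, u \in S -> succ b u \in S) -> v \in S ->
  (ord0 \in S) || (inord l \in S).
Proof.
move=> Sb.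
(* [m] measures what is left before the next base point, with both halves of the circle given length
   [n - l]. Switching preserves it, and the step along the circle lowers it by one unless a base
   point is reached. *)
pose m (k : nat) := (if k < l then n - l - k else n - k)%N.
have [d] := ubnP (m v); elim: d v => // d IH v md vS.
have sv := val_succ b v; have svS := Sb _ vS.
have [|] := boolP ((val (succ b v) == 0) || (val (succ b v) == l))%N.
  case/orP => /eqP E.
    have <- : succ b v = ord0 by apply/val_inj.
    by rewrite svS.
  have <- : succ b v = inord l.
    by apply/val_inj; rewrite E -[RHS]/(nat_of_ord _) inordK//; lia.
  by rewrite svS orbT.
move=> /norP[/eqP s0 /eqP sl]; apply: IH svS; move: md.
have mE k : (k < l /\ m k = n - l - k) \/ (l <= k /\ m k = n - k).
  by rewrite /m; case: ltnP; [left|right].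
have := mE v; have := mE (succ b v); have := ltn_ord v; have := switchP b v.
rewrite -[nat_of_ord (succ b v)]/(val (succ b v)); move: s0 sl; rewrite sv.
have := wrapP (switch b v); move: (switch b v) => y.
by set y' := (if y == n' then 0 else y.+1); clearbody y' m; lia.
Qed.

Lemma mem_porbit_succ b u v :
  (succ b v \in porbit (succ_perm b) u) = (v \in porbit (succ_perm b) u).
Proof.
rewrite -succ_permE.
by rewrite -!eq_porbit_mem; have := porbit_perm (succ_perm b) 1 v; rewrite expg1 => ->.
Qed.

Lemma odd_orbits_closed b (S : {set 'I_n}) : odd_orbits b ->
  (forall v, v \in S -> succ b v \in S) -> S = finset.set0 \/ S = [set: 'I_n].
Proof.
move=> ob Sb; have [->|/set0Pn[v vS]] := eqVneq S finset.set0; first by left.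
right; set s := succ_perm b in ob.
have sub : porbits s \subset [set porbit s ord0; porbit s (inord l)].
  apply/fintype.subsetP => _ /imsetP[u _ ->].
  have := @closed_meets_base b (porbit s u) u _ (porbit_id _ _).
  case/(_ _)/orP => [w||]; first by rewrite mem_porbit_succ.
    by rewrite -eq_porbit_mem => /eqP <-; rewrite set21.
  by rewrite -eq_porbit_mem => /eqP <-; rewrite set22.
have /cards1P[A AE] : #|porbits s| == 1%N.
  have : #|porbits s| <= 2.
    by rewrite (leq_trans (subset_leq_card sub))// cards2; case: (_ != _).
  by move: ob; rewrite /odd_orbits -/s; case: #|_| => [|[|[|]]].
have po u : porbit s u = A by apply/set1P; rewrite -AE imset_f.
have iterS k : (s ^+ k)%g v \in S.
  elim: k => [|k IH]; first by rewrite expg0 perm1.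
  by rewrite expgSr permM succ_permE; apply: Sb.
apply/setP => u; rewrite inE.
have : u \in porbit s v by rewrite po -(po u) porbit_id.
by case/porbitP=> k ->; exact: iterS.
Qed.

(** The orbit of node 0 is proper, since a single orbit would make the count odd; its cut constraint
    is the one that a hidden point violates. *)
Lemma even_orbits_closed b : ~~ odd_orbits b -> exists S : {set 'I_n},
  [/\ forall v, (succ b v \in S) = (v \in S), S != finset.set0 & S != [set: 'I_n]].
Proof.
move=> eb; exists (porbit (succ_perm b) ord0); split.
- by move=> v; rewrite mem_porbit_succ.
- by apply/set0Pn; exists ord0; exact: porbit_id.
- apply: contra eb => /eqP pT; rewrite /odd_orbits.
  have -> : porbits (succ_perm b) = [set [set: 'I_n]].
    apply/setP => A; rewrite inE; apply/imsetP/eqP => [[u _ ->]|->].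
      by rewrite -pT; apply/eqP; rewrite eq_porbit_mem pT inE.
    by exists ord0.
  by rewrite cards1.
Qed.

(** The bits below [l.-1] are free and bit [l.-1] repairs the parity, so distinct tuples still
    differ at a free bit. *)
Lemma even_orbits_family : exists B : l.-1.-tuple bool -> nat -> bool,
  (forall t, ~~ odd_orbits (B t)) /\
  (forall t t', t != t' -> exists2 i, (i < l)%N & B t i != B t' i).
Proof.
exists (fun t => if odd_orbits (nth false t)
  then toggle l.-1 (nth false t) else nth false t).
split=> [t|t t' tt'].
  have [ot|//] := ifP; first by rewrite odd_orbits_toggle ?ot//; lia.
  by move=> ->.
have [i il ti] : exists2 i, (i < l.-1)%N & nth false t i != nth false t' i.
  apply: contrapT => nex; move/eqP: tt'; apply; apply/val_inj.
  apply: (@eq_from_nth _ false); rewrite ?size_tuple// => i il.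
  by apply/eqP/negPn/negP => ti; apply: nex; exists i.
exists i; first by lia.
have il' : (i == l.-1) = false by lia.
by case: ifP => _; case: ifP => _; rewrite /toggle ?il'.
Qed.

End Switches.

(** * Upper bounds from box, degree and cut inequalities *)

Section UpperBounds.
Variables (R : realType) (n : nat).

Definition proper_part (S : {set 'I_n}) := (S != finset.set0) && (S != [set: 'I_n]).

(** A right-hand side of 0 for trivial [S] and 1 otherwise lets the cut inequalities be indexed by
    all sets of nodes. *)
Lemma cut_boolP (T : finType) (F : {set 'I_n} -> {set T}) (G : {set T}) :
  (forall S, S != finset.set0 -> S != [set: 'I_n] -> 0 < #|F S :&: G|)%N <->
  (forall S, (proper_part S <= #|F S :&: G|)%N).
Proof.
split=> FG S; last by move=> S0 ST; have := FG S; rewrite /proper_part S0 ST.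
by have [/andP[]|//] := boolP (proper_part S); exact: FG.
Qed.

Lemma rc_ATSP_le : (1 < n)%N ->
  (rc (ATSP R n) <= (#|{: darc n}| + #|{: darc n}| + #|{: 'I_n + {set 'I_n}}|)%:R%:E)%E.
Proof.
move=> n1.
pose a (i : 'I_n + {set 'I_n}) : {ffun darc n -> R^o} :=
  match i with inl v => char_vec R (out_arcs v) | inr A => - char_vec R (dcut A) end.
pose b (i : 'I_n + {set 'I_n}) : R :=
  match i with inl _ => 1 | inr A => - (proper_part A)%:R end.
apply: (@rc_le_card R _ (@directed_hamiltonian_cycle n) _ a b) => F.
rewrite directed_hamiltonian_cycleP// cut_boolP.
split=> [[out cutF] [v|S]|ab] /=.
- by rewrite dot_char_vec2 (ler_nat R _ 1).
- by rewrite dotNl dot_char_vec2 lerN2 ler_nat.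
split=> [v|S].
  by have := ab (inl v); rewrite /= dot_char_vec2 (ler_nat R _ 1).
by have := ab (inr S); rewrite /= dotNl dot_char_vec2 lerN2 ler_nat.
Qed.

Lemma rc_STSP_le : (2 < n)%N ->
  (rc (STSP R n) <= (#|{: edge n}| + #|{: edge n}| + #|{: 'I_n + 'I_n + {set 'I_n}}|)%:R%:E)%E.
Proof.
move=> n2.
pose a (i : 'I_n + 'I_n + {set 'I_n}) : {ffun edge n -> R^o} :=
  match i with
  | inl (inl v) => char_vec R (incident v) | inl (inr v) => - char_vec R (incident v)
  | inr A => - char_vec R (cut A) end.
pose b (i : 'I_n + 'I_n + {set 'I_n}) : R :=
  match i with inl (inl _) => 2 | inl (inr _) => - 2 | inr A => - (proper_part A)%:R end.
apply: (@rc_le_card R _ (@hamiltonian_cycle n) _ a b) => F.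
rewrite hamiltonian_cycleP// cut_boolP.
split=> [[deg cutF] [[v|v]|S]|ab] /=.
- by rewrite dot_char_vec2 deg.
- by rewrite dotNl dot_char_vec2 deg.
- by rewrite dotNl dot_char_vec2 lerN2 ler_nat.
split=> [v|S].
  have := ab (inl (inl v)); have := ab (inl (inr v)).
  rewrite /= dotNl dot_char_vec2 lerN2 !ler_nat => v2 v2'.
  by apply/eqP; rewrite eqn_leq v2 v2'.
by have := ab (inr S); rewrite /= dotNl dot_char_vec2 lerN2 ler_nat.
Qed.

Lemma card_edge_le : (#|{: edge n}| <= 2 ^ n)%N.
Proof.
have := leq_card _ (@val_inj _ _ (edge n)).
by rewrite -[X in (_ <= X)%N -> _]cardsT -powersetT card_powerset cardsT card_ord.
Qed.

Lemma card_darc_le : (#|{: darc n}| <= 2 ^ n * 2 ^ n)%N.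
Proof.
have := leq_card _ (@val_inj _ _ (darc n)); rewrite card_prod card_ord => /leq_trans; apply.
by apply: leq_mul; exact/ltnW/ltn_expl.
Qed.

Lemma card_set_ord : #|{: {set 'I_n}}| = (2 ^ n)%N.
Proof. by rewrite -cardsT -powersetT card_powerset cardsT card_ord. Qed.

End UpperBounds.

(** * Lower bounds from the switched successor maps *)

Section LowerBounds.
Variables (R : realType) (n' l : nat).
Local Notation n := n'.+1.
Hypothesis ln : (n = l.*2 \/ n = l.*2.+1)%N.
Hypothesis l4 : (4 <= l)%N.

Lemma ltn_card_tuple : (2 < #|{: l.-1.-tuple bool}|)%N.
Proof.
rewrite card_tuple card_bool; apply: (@leq_trans (2 ^ 3)%N) => //.
by rewrite leq_exp2l//; lia.
Qed.

Lemma exists_cyclic_succ b : odd_orbits ln l4 b ->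
  exists2 c : n.-tuple 'I_n, uniq c & forall v, next c v = succ l b v.
Proof.
by move=> ob; apply: exists_cyclic_tuple => // S; apply: odd_orbits_closed ob.
Qed.

Lemma rc_ATSP_ge : ((2 ^ l.-1)%:R%:E <= rc (ATSP R n))%E.
Proof.
pose arcs b : {set darc n} := [set a : darc n | (val a).2 == succ l b (val a).1].
have [B [evenB neqB]] := even_orbits_family ln l4.
have -> : (2 ^ l.-1)%N = #|{: l.-1.-tuple bool}| by rewrite card_tuple card_bool.
apply: (@rc_ge_card _ _ _ _ (fun t => char_vec R (arcs (B t)))).
- exact: ltn_card_tuple.
- by move=> _ [F _ <-]; exact: char_vec_integer.
- by move=> t; exact: char_vec_integer.
- move=> t; have [S [SB S0 ST]] := even_orbits_closed (evenB t).
  (* No arc of the switched map leaves the invariant set [S], while every hamiltonian cycle has one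
     that does. *)
  exists (- char_vec R (dcut S)), (- 1); split.
    move=> _ [F hF <-]; have n1 : (1 < n)%N by lia.
    have [_ /(_ S S0 ST) SF] := (directed_hamiltonian_cycleP F n1).1 hF.
    by rewrite dotNl dot_char_vec2 lerN2 (ler_nat R 1).
  rewrite dotNl dot_char_vec2 ltrN2 (ltr_nat R _ 1) ltnS leqn0 cards_eq0.
  apply/eqP/setP => a; rewrite !inE; apply/negP => /andP[/andP[aS]] /[swap] /eqP ->.
  by rewrite SB aS.
- move=> t t' /neqB[i il Bi].
  have hamT b : ~~ odd_orbits ln l4 b ->
      ATSP R n (char_vec R (arcs (toggle i b))).
    move=> eb; have [|c Uc cE] := @exists_cyclic_succ (toggle i b).
      by rewrite odd_orbits_toggle.
    exists (arcs (toggle i b)) => //; split; first by lia.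
    by exists c => //; apply/setP => a; rewrite !inE cE.
  exists (char_vec R (arcs (toggle i (B t)))), (char_vec R (arcs (toggle i (B t')))).
  split; [exact: hamT|exact: hamT|apply/ffunP => a; rewrite !ffunE !inE].
  exact: (succ_toggle2 (fun w => ((val a).2 == w)%:R : R^o) _ il Bi).
Qed.

(** Without 2-cycles each edge comes from at most one [v], so the existential becomes a sum, to
    which the exchange of successors applies term by term. *)
Lemma char_vec_edges (f : 'I_n -> 'I_n) e : (forall v, f (f v) != v) ->
  char_vec R [set e : edge n | [exists v, val e == [set v; f v]]] e =
  \sum_v (val e == [set v; f v])%:R.
Proof.
move=> ff; rewrite ffunE inE; case: existsP => [[v /eqP ev]|nex].
  rewrite (bigD1 v)//= ev eqxx big1 ?addr0// => w wv.
  case: eqP => // /eq_set2[[E _]|[E1 E2]]; first by rewrite E eqxx in wv.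
  by have := ff w; rewrite -E1 E2 eqxx.
by rewrite big1// => v _; case: eqP => // ev; case: nex; exists v; apply/eqP.
Qed.

Lemma rc_STSP_ge : ((2 ^ l.-1)%:R%:E <= rc (STSP R n))%E.
Proof.
pose edges b : {set edge n} :=
  [set e : edge n | [exists v, val e == [set v; succ l b v]]].
have [B [evenB neqB]] := even_orbits_family ln l4.
have -> : (2 ^ l.-1)%N = #|{: l.-1.-tuple bool}| by rewrite card_tuple card_bool.
apply: (@rc_ge_card _ _ _ _ (fun t => char_vec R (edges (B t)))).
- exact: ltn_card_tuple.
- by move=> _ [F _ <-]; exact: char_vec_integer.
- by move=> t; exact: char_vec_integer.
- move=> t; have [S [SB S0 ST]] := even_orbits_closed (evenB t).
  exists (- char_vec R (cut S)), (- 1); split.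
    move=> _ [F hF <-]; have n2 : (2 < n)%N by lia.
    have [_ /(_ S S0 ST) SF] := (hamiltonian_cycleP F n2).1 hF.
    by rewrite dotNl dot_char_vec2 lerN2 (ler_nat R 1).
  rewrite dotNl dot_char_vec2 ltrN2 (ltr_nat R _ 1) ltnS leqn0 cards_eq0.
  apply/eqP/setP => e; rewrite !inE; apply/negP => /andP[].
  move=> /exists_inP[v vS /exists_inP[w]]; rewrite inE => wS /eqP -> /existsP[u].
  move=> /eqP/eq_set2[[vu wu]|[vu wu]].
    by rewrite wu -vu SB vS in wS.
  by rewrite wu -(SB u) -vu vS in wS.
- move=> t t' /neqB[i il Bi].
  have hamT b : ~~ odd_orbits ln l4 b ->
      STSP R n (char_vec R (edges (toggle i b))).
    move=> eb; have [|c Uc cE] := @exists_cyclic_succ (toggle i b).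
      by rewrite odd_orbits_toggle.
    exists (edges (toggle i b)) => //; split; first by lia.
    exists c => //; apply/setP => e; rewrite !inE.
    by apply: eq_existsb => v; rewrite cE.
  exists (char_vec R (edges (toggle i (B t)))), (char_vec R (edges (toggle i (B t')))).
  split; [exact: hamT|exact: hamT|apply/ffunP => e].
  rewrite [LHS]ffunE [RHS]ffunE !char_vec_edges;
    try by move=> v; exact: (succ_succ_neq ln l4).
  rewrite -!big_split; apply: eq_bigr => v _.
  exact: (succ_toggle2 (fun w => (val e == [set v; w])%:R : R^o) _ il Bi).
Qed.

End LowerBounds.

Theorem theorem3 (R : realType) :
  exists c1 c2 : R, 0 < c1 /\ 0 < c2 /\
    exists N : nat, forall n : nat, (N <= n)%N ->
      ((2 `^ (c1 * n%:R))%:E <= rc (ATSP R n) <= (2 `^ (c2 * n%:R))%:E)%E /\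
      ((2 `^ (c1 * n%:R))%:E <= rc (STSP R n) <= (2 `^ (c2 * n%:R))%:E)%E.
Proof.
(* For [n >= 8], half of [n] rounded down is some [l >= 4] with [n <= 4 * (l - 1)], which gives
   [4^-1]; the number of inequalities is at most [8 * 4 ^ n <= 2 ^ (5 * n)], which gives 5. *)
exists 4^-1, 5; split; first by rewrite invr_gt0.
split=> //; exists 8 => -[//|n'] n8; set n := n'.+1; pose l := n./2.
have ln : (n = l.*2 \/ n = l.*2.+1)%N.
  by have := odd_double_half n; rewrite -/l; case: odd => <-; [right|left].
have l4 : (4 <= l)%N by lia.
have lower : ((2 `^ (4^-1 * n%:R))%:E <= (2 ^ l.-1)%:R%:E :> \bar R)%E.
  rewrite lee_fin natrX -powR_mulrn// ler_powR ?ler1n//.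
  rewrite ler_pdivrMl// -[4]/(4%:R) -natrM ler_nat; lia.
have upper k : (k <= 2 ^ (5 * n))%N -> (k%:R%:E <= (2 `^ (5 * n%:R))%:E :> \bar R)%E.
  move=> k5; rewrite lee_fin -[5]/(5%:R) -natrM powR_mulrn// -natrX ler_nat//.
have n2 : (n <= 2 ^ n)%N by rewrite ltnW// ltn_expl.
have p1 : (1 <= 2 ^ n)%N by rewrite expn_gt0.
have p5 : (8 * (2 ^ n * 2 ^ n) <= 2 ^ (5 * n))%N.
  rewrite -[8%N]/(2 ^ 3)%N -!expnD leq_exp2l//; lia.
have := card_darc_le n; have := card_edge_le n => eb db.
split; apply/andP; split.
- exact: le_trans lower (rc_ATSP_ge R ln l4).
- apply: le_trans (rc_ATSP_le R _) (upper _ _); first by lia.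
  by rewrite card_sum card_ord card_set_ord; nia.
- exact: le_trans lower (rc_STSP_ge R ln l4).
- apply: le_trans (rc_STSP_le R _) (upper _ _); first by lia.
  by rewrite !card_sum card_ord card_set_ord; nia.
Qed.
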